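(* Let $g_1,\dots,g_N$ be unit vectors in $\mathbb{R}^2$, no two of them parallel, and let $\gamma_1,\dots,\gamma_N\in\mathbb{R}$ be such that the $N$-grid they define is regular. Then the grid tiling associated with this grid has a growth form, and this growth form is the polygon whose vertices are the $2N$ points $$\pm\frac{\upsilon_i}{\Delta_i},\qquad i=1,\dots,N,$$ (i.e. the boundary of the convex hull of these points), where for $i\neq j$: $\alpha_{ij}=\arccos|(g_i,g_j)|$, $\delta_{ij}=1/\sin\alpha_{ij}$, $D_{ij}=\det\begin{pmatrix}g_{i1}&g_{i2}\\ g_{j1}&g_{j2}\end{pmatrix}$ (with $g_i=(g_{i1},g_{i2})$), $\epsilon_{ij}=1$ if $D_{ij}>0$ and $\epsilon_{ij}=-1$ if $D_{ij}<0$, and $$\Delta_i=\sum_{j\neq i}\frac{1}{\delta_{ij}},\qquad \upsilon_i=\sum_{j\neq i}\frac{\epsilon_{ij}\,g_j}{\delta_{ij}}.$$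
   Context: Grid construction (in $\mathbb{R}^d$, here $d=2$): given unit vectors $g_1,\dots,g_N$ and reals $\gamma_1,\dots,\gamma_N$, the $N$-grid is the union of the $N$ families of equidistant parallel hyperplanes (lines, for $d=2$) $\{x\in\mathbb{R}^d:(x,g_i)-\gamma_i\in\mathbb{Z}\}$, $1\le i\le N$, where $(\cdot,\cdot)$ is the standard scalar product. The grid is regular if no point of $\mathbb{R}^d$ lies on more than $d$ of these hyperplanes. The grid decomposes $\mathbb{R}^d$ into cells (closures of connected components of the complement). Define $K_i(x)=\min\{n\in\mathbb{Z}: n\ge (x,g_i)-\gamma_i\}$ and $K(x)=\sum_{i=1}^N K_i(x)g_i$; $K$ is constant on the interior of each cell, so it maps cells to a discrete set $\Lambda\subset\mathbb{R}^d$. The grid tiling is the tiling with vertex set $\Lambda$ in which two points of $\Lambda$ are joined by an edge iff the corresponding cells share a facet (an edge when $d=2$), and whose tiles are, for each intersection point of $d$ grid hyperplanes, the parallelotope (rhombus when $d=2$) whose vertices are the $K$-images of the $2^d$ cells containing that point. Growth form: two tiles of a tiling of $\mathbb{R}^d$ are neighbours if their intersection has positive $(d-1)$-dimensional volume. A chain is a finite sequence of tiles with consecutive tiles neighbours; its length is the number of tiles minus one; the distance between two tiles is the minimal length of a chain joining them. Given a finite nonempty set $P_0$ of tiles, the $n$-th coordination shell $P_n$ is the set of tiles at distance exactly $n$ from $P_0$. A closed $(d-1)$-dimensional surface $F\subset\mathbb{R}^d$ is a growth form of the tiling if there exist a point $x$ and a constant $C$ such that for all $n$ the shell $P_n$ lies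 in the $C$-neighbourhood of $x+nF$ (this does not depend on $P_0$). *)

(* Defs.v *)
From Stdlib Require Import Reals Lra Lia List.
Import ListNotations.
Open Scope R_scope.

Definition pt : Type := (R * R)%type.

Definition vadd (u v : pt) : pt := (fst u + fst v, snd u + snd v).
Definition vscale (a : R) (u : pt) : pt := (a * fst u, a * snd u).
Definition vsub (u v : pt) : pt := vadd u (vscale (-1) v).
Definition vzero : pt := (0, 0).
Definition dot (u v : pt) : R := fst u * fst v + snd u * snd v.
Definition vnorm (u : pt) : R := sqrt (dot u u).
Definition dist (u v : pt) : R := vnorm (vsub u v).
Definition det2 (u v : pt) : R := fst u * snd v - snd u * fst v.

Definition vsum (f : nat -> pt) (l : list nat) : pt :=
  fold_right (fun j acc => vadd (f j) acc) vzero l.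
Definition rsum (f : nat -> R) (l : list nat) : R :=
  fold_right (fun j acc => f j + acc) 0 l.

Definition is_int (t : R) : Prop := exists z : Z, t = IZR z.

(* ceiling: min { n in Z | n >= t } ;  up s is the integer with s < up s <= s+1 *)
Definition ceilZ (t : R) : Z := (1 - up (- t))%Z.

Definition on_family (g : nat -> pt) (gam : nat -> R) (i : nat) (x : pt) : Prop :=
  is_int (dot x (g i) - gam i).

Definition on_grid (N : nat) (g : nat -> pt) (gam : nat -> R) (x : pt) : Prop :=
  exists i, (i < N)%nat /\ on_family g gam i x.

(* regular: no point lies on more than d = 2 grid lines.  Lines of the same
   family are disjoint, so this says no point lies on lines of three distinct
   families. *)
Definition regular_grid (N : nat) (g : nat -> pt) (gam : nat -> R) : Prop :=
  forall (x : pt) (i j k : nat), (i < N)%nat -> (j < N)%nat -> (k < N)%nat ->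
    i <> j -> j <> k -> i <> k ->
    ~ (on_family g gam i x /\ on_family g gam j x /\ on_family g gam k x).

Definition Kc (g : nat -> pt) (gam : nat -> R) (i : nat) (x : pt) : Z :=
  ceilZ (dot x (g i) - gam i).
Definition Kmap (N : nat) (g : nat -> pt) (gam : nat -> R) (x : pt) : pt :=
  vsum (fun i => vscale (IZR (Kc g gam i x)) (g i)) (seq 0 N).

Definition grid_vertex (N : nat) (g : nat -> pt) (gam : nat -> R) (p : pt) : Prop :=
  exists i j, (i < N)%nat /\ (j < N)%nat /\ i <> j /\
    on_family g gam i p /\ on_family g gam j p.

(* v is the K-image of a cell containing p: K takes the value v at points of
   the complement of the grid arbitrarily close to p (K is constant on the
   interior of each cell, and the cells containing p are exactly those having
   interior points arbitrarily close to p). *)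
Definition cell_image_at (N : nat) (g : nat -> pt) (gam : nat -> R) (p v : pt) : Prop :=
  forall eps, 0 < eps -> exists y, dist y p < eps /\ ~ on_grid N g gam y /\
    Kmap N g gam y = v.

Definition conv (S : pt -> Prop) (x : pt) : Prop :=
  exists l : list (R * pt),
    Forall (fun wp => 0 <= fst wp /\ S (snd wp)) l /\
    fold_right (fun wp acc => fst wp + acc) 0 l = 1 /\
    x = fold_right (fun wp acc => vadd (vscale (fst wp) (snd wp)) acc) vzero l.

(* the tile (rhombus) associated with the intersection point p:
   the parallelogram whose vertices are the K-images of the cells containing p *)
Definition tile_at (N : nat) (g : nat -> pt) (gam : nat -> R) (p : pt) : pt -> Prop :=
  conv (cell_image_at N g gam p).

Definition is_tile (N : nat) (g : nat -> pt) (gam : nat -> R) (T : pt -> Prop) : Prop :=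
  exists p, grid_vertex N g gam p /\ T = tile_at N g gam p.

(* positive 1-dimensional volume of an intersection of two (convex) tiles:
   it contains a non-degenerate segment *)
Definition segment (a b : pt) (x : pt) : Prop :=
  exists t, 0 <= t <= 1 /\ x = vadd (vscale (1 - t) a) (vscale t b).

Definition neighbours (T1 T2 : pt -> Prop) : Prop :=
  exists a b, a <> b /\ forall x, segment a b x -> T1 x /\ T2 x.

Inductive chain_from (istile : (pt -> Prop) -> Prop) (P0 : list (pt -> Prop))
  : nat -> (pt -> Prop) -> Prop :=
| chain0 : forall T, In T P0 -> chain_from istile P0 0 T
| chainS : forall n T T', chain_from istile P0 n T -> istile T' ->
    neighbours T T' -> chain_from istile P0 (S n) T'.

Definition shell (istile : (pt -> Prop) -> Prop) (P0 : list (pt -> Prop))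
  (n : nat) (T : pt -> Prop) : Prop :=
  istile T /\ chain_from istile P0 n T /\
  forall m, (m < n)%nat -> ~ chain_from istile P0 m T.

Definition growth_form_wrt (istile : (pt -> Prop) -> Prop) (P0 : list (pt -> Prop))
  (F : pt -> Prop) : Prop :=
  exists (x : pt) (C : R), forall (n : nat) (T : pt -> Prop), shell istile P0 n T ->
    forall y, T y -> exists z, F z /\
      dist y (vadd x (vscale (INR n) z)) <= C.

Definition boundary (S : pt -> Prop) (y : pt) : Prop :=
  (forall eps, 0 < eps -> exists z, dist z y < eps /\ S z) /\
  (forall eps, 0 < eps -> exists z, dist z y < eps /\ ~ S z).

Definition alpha (g : nat -> pt) (i j : nat) : R := acos (Rabs (dot (g i) (g j))).
Definition delta (g : nat -> pt) (i j : nat) : R := / sin (alpha g i j).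
Definition Dij (g : nat -> pt) (i j : nat) : R := det2 (g i) (g j).
Definition epsij (g : nat -> pt) (i j : nat) : R :=
  if Rlt_dec 0 (Dij g i j) then 1 else -1.

Definition Delta (N : nat) (g : nat -> pt) (i : nat) : R :=
  rsum (fun j => if Nat.eq_dec j i then 0 else / delta g i j) (seq 0 N).
Definition upsilon (N : nat) (g : nat -> pt) (i : nat) : pt :=
  vsum (fun j => if Nat.eq_dec j i then vzero
                 else vscale (epsij g i j / delta g i j) (g j)) (seq 0 N).

Definition polygon_vertices (N : nat) (g : nat -> pt) (y : pt) : Prop :=
  exists i, (i < N)%nat /\
    (y = vscale (/ Delta N g i) (upsilon N g i) \/
     y = vscale (- / Delta N g i) (upsilon N g i)).

Definition growth_polygon (N : nat) (g : nat -> pt) : pt -> Prop :=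
  boundary (conv (polygon_vertices N g)).

(* Main.v *)
Require Import Defs.
From Stdlib Require Import Reals List.
From Stdlib Require Import Lra Lia Classical.
Open Scope R_scope.

(** Replace the ceiling function by its maximal monotone graph (vertical segments
    filled in).  The tile of a grid vertex [p] is then the set of all sums
    [sum_m y_m g_m] with [y_m] in the graph over [(p, g_m) - gamma_m], and
    monotonicity shows that the tiles of [p] and [q] can share a segment only if
    the number of grid lines separating [p] and [q], those through just one of them
    counting one half, is at most one.  Hence this number is a lower bound for the
    distance of the tiles of any [p] and [q]; up to a bounded error it is
    [|p - q|_g = sum_m |(p - q, g_m)|].  It is attained up to a constant: the
    unit ball of [|.|_g] has its vertices on the directions of the grid lines, so
    that [q] is reached from [p] by following two suitable grid lines, after a
    bounded detour at both ends.  Finally the tile of [p] lies near [A p] up to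
    translation, where [A v = sum_m (v, g_m) g_m]; with [e_i] orthogonal to [g_i]
    one has [|e_i|_g = Delta_i] and [A e_i = upsilon_i], so [A] maps the unit
    sphere of [|.|_g] onto the stated polygon. *)

(** * Finite sums *)

Lemma rsum_ext f f' l : (forall m, In m l -> f m = f' m) -> rsum f l = rsum f' l.
Proof.
  induction l as [|m l IH]; intros H; simpl; [reflexivity|].
  rewrite (H m (or_introl eq_refl)), IH; [reflexivity|].
  intros k Hk; apply H; right; exact Hk.
Qed.

Lemma rsum_le f f' l : (forall m, In m l -> f m <= f' m) -> rsum f l <= rsum f' l.
Proof.
  induction l as [|m l IH]; intros H; simpl; [lra|].
  assert (H1 := H m (or_introl eq_refl)).
  assert (H2 : rsum f l <= rsum f' l) by (apply IH; intros k Hk; apply H; right; exact Hk).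
  lra.
Qed.

Lemma rsum_plus f f' l : rsum (fun m => f m + f' m) l = rsum f l + rsum f' l.
Proof. induction l as [|m l IH]; simpl; [|rewrite IH]; ring. Qed.

Lemma rsum_scal a f l : rsum (fun m => a * f m) l = a * rsum f l.
Proof. induction l as [|m l IH]; simpl; [|rewrite IH]; ring. Qed.

Lemma rsum_const a l : rsum (fun _ => a) l = INR (length l) * a.
Proof.
  induction l as [|m l IH]; [simpl; ring|].
  change (length (m :: l)) with (S (length l)).
  rewrite S_INR; simpl rsum; rewrite IH; ring.
Qed.

Lemma rsum_zero f l : (forall m, In m l -> f m = 0) -> rsum f l = 0.
Proof.
  intros H; rewrite (rsum_ext f (fun _ => 0) l H), rsum_const; ring.
Qed.

Lemma rsum_nonneg f l : (forall m, In m l -> 0 <= f m) -> 0 <= rsum f l.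
Proof.
  intros H; apply Rle_trans with (rsum (fun _ => 0) l); [|now apply rsum_le].
  rewrite rsum_const; lra.
Qed.

Lemma rsum_term_le f l k : (forall m, In m l -> 0 <= f m) -> In k l -> f k <= rsum f l.
Proof.
  induction l as [|m l IH]; intros H Hk; [destruct Hk|simpl].
  assert (Hm := H m (or_introl eq_refl)).
  assert (Hl : forall n, In n l -> 0 <= f n) by (intros n Hn; apply H; right; exact Hn).
  destruct Hk as [<-|Hk].
  - assert (H0 := rsum_nonneg f l Hl); lra.
  - assert (H0 := IH Hl Hk); lra.
Qed.

Lemma rsum_nonneg_eq0 f l k :
  (forall m, In m l -> 0 <= f m) -> rsum f l = 0 -> In k l -> f k = 0.
Proof.
  intros H H0 Hk.
  assert (H1 := rsum_term_le f l k H Hk); assert (H2 := H k Hk); lra.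
Qed.

Lemma rsum_single f l i : NoDup l -> In i l ->
  (forall m, In m l -> m <> i -> f m = 0) -> rsum f l = f i.
Proof.
  induction l as [|m l IH]; intros Hd Hi H; [destruct Hi|simpl].
  apply NoDup_cons_iff in Hd as [Hm Hd'].

  destruct Hi as [<-|Hi].
  - rewrite rsum_zero; [ring|].
    intros k Hk; apply H; [now right|]; intros ->; contradiction.
  - rewrite IH; trivial.
    + rewrite (H m); [ring|now left|]; intros ->; contradiction.
    + intros k Hk; apply H; now right.
Qed.

Lemma rsum_two f l i j : NoDup l -> In i l -> In j l -> i <> j ->
  (forall m, In m l -> m <> i -> m <> j -> f m = 0) -> rsum f l = f i + f j.
Proof.
  intros Hd Hi Hj Hij H.
  rewrite (rsum_ext f (fun m => (if Nat.eq_dec m i then f i else 0)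
                            + (if Nat.eq_dec m j then f j else 0)) l).
  - rewrite rsum_plus, (rsum_single _ l i Hd Hi), (rsum_single _ l j Hd Hj).
    + now destruct (Nat.eq_dec i i), (Nat.eq_dec j j).
    + intros m _ Hm; now destruct (Nat.eq_dec m j).
    + intros m _ Hm; now destruct (Nat.eq_dec m i).
  - intros m Hm.
    destruct (Nat.eq_dec m i) as [Ei|Ei], (Nat.eq_dec m j) as [Ej|Ej].
    + congruence.
    + rewrite Ei; ring.
    + rewrite Ej; ring.
    + rewrite H; trivial; ring.
Qed.

Lemma fst_vsum f l : fst (vsum f l) = rsum (fun m => fst (f m)) l.
Proof. induction l as [|m l IH]; simpl; [|rewrite IH]; reflexivity. Qed.

Lemma snd_vsum f l : snd (vsum f l) = rsum (fun m => snd (f m)) l.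
Proof. induction l as [|m l IH]; simpl; [|rewrite IH]; reflexivity. Qed.

Lemma initial_segment_bounded (f : nat -> R) n : exists K, 0 <= K /\ forall i, (i < n)%nat -> f i <= K.
Proof.
  exists (rsum (fun m => Rabs (f m)) (seq 0 n)); split.
  - apply rsum_nonneg; intros; apply Rabs_pos.
  - intros i Hi; apply Rle_trans with (Rabs (f i)); [apply Rle_abs|].
    apply (rsum_term_le (fun m => Rabs (f m))); [intros; apply Rabs_pos|].
    apply in_seq; lia.
Qed.

(** Finitely many positive radii have a positive minimum, and shrinking a radius keeps it
    admissible. *)
Lemma common_radius (P : nat -> R -> Prop) n :
  (forall i e e', P i e -> 0 < e' <= e -> P i e') ->
  (forall i, (i < n)%nat -> exists e, 0 < e /\ P i e) ->
  exists e, 0 < e /\ forall i, (i < n)%nat -> P i e.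
Proof.
  intros Hmono; induction n as [|n IH]; intros H.
  - exists 1; split; [lra|]; intros; lia.
  - destruct IH as [e [He H1]]; [intros; apply H; lia|].
    destruct (H n) as [e' [He' H2]]; [lia|].
    exists (Rmin e e'); split; [now apply Rmin_pos|].
    intros i Hi; assert (Hm : 0 < Rmin e e') by now apply Rmin_pos.
    destruct (Nat.eq_dec i n) as [->|Hn].
    + apply Hmono with e'; trivial; split; trivial; apply Rmin_r.
    + apply Hmono with e; [apply H1; lia|]; split; trivial; apply Rmin_l.
Qed.

(** * Plane vectors *)

Lemma pt_eq (u v : pt) : fst u = fst v -> snd u = snd v -> u = v.
Proof. destruct u, v; simpl; congruence. Qed.

Ltac pt_ring := apply pt_eq; unfold vsub, vadd, vscale, vzero; simpl; ring.

Lemma dot_vadd u v w : dot (vadd u v) w = dot u w + dot v w.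
Proof. unfold dot, vadd; simpl; ring. Qed.

Lemma dot_vscale a u w : dot (vscale a u) w = a * dot u w.
Proof. unfold dot, vscale; simpl; ring. Qed.

Lemma dot_vsub u v w : dot (vsub u v) w = dot u w - dot v w.
Proof. unfold dot, vsub, vadd, vscale; simpl; ring. Qed.

Lemma vsub_eq0 u v : vsub u v = vzero -> u = v.
Proof.
  unfold vsub, vadd, vscale, vzero; simpl; intros H; injection H; intros.
  apply pt_eq; lra.
Qed.

Lemma vnorm_pos u : 0 <= vnorm u.
Proof. apply sqrt_pos. Qed.

Lemma dot_self_pos u : 0 <= dot u u.
Proof. unfold dot; nra. Qed.

Lemma vnorm_sqr u : vnorm u * vnorm u = dot u u.
Proof. apply sqrt_sqrt, dot_self_pos. Qed.

Lemma dot_le_vnorm u v : Rabs (dot u v) <= vnorm u * vnorm v.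
Proof.
  assert (Hu := vnorm_pos u); assert (Hv := vnorm_pos v).
  rewrite <- (Rabs_pos_eq (vnorm u * vnorm v)) by nra.
  apply Rsqr_le_abs_0; unfold Rsqr.
  replace (vnorm u * vnorm v * (vnorm u * vnorm v))
    with (vnorm u * vnorm u * (vnorm v * vnorm v)) by ring.
  rewrite !vnorm_sqr.
  assert (H := Rle_0_sqr (fst u * snd v - snd u * fst v)); unfold Rsqr in H.
  unfold dot; lra.
Qed.

Lemma vnorm_vadd u v : vnorm (vadd u v) <= vnorm u + vnorm v.
Proof.
  assert (Hu := vnorm_pos u); assert (Hv := vnorm_pos v).
  assert (Hw := vnorm_pos (vadd u v)).
  apply Rsqr_incr_0_var; [|lra]; unfold Rsqr.
  rewrite vnorm_sqr.
  replace (dot (vadd u v) (vadd u v)) with (dot u u + 2 * dot u v + dot v v)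
    by (unfold dot, vadd; simpl; ring).
  assert (H := dot_le_vnorm u v); assert (H' := Rle_abs (dot u v)).
  rewrite <- (vnorm_sqr u), <- (vnorm_sqr v); nra.
Qed.

Lemma vnorm_vscale a u : vnorm (vscale a u) = Rabs a * vnorm u.
Proof.
  unfold vnorm; rewrite <- (sqrt_Rsqr_abs a), <- sqrt_mult;
    [|apply Rle_0_sqr|apply dot_self_pos].
  f_equal; unfold dot, vscale, Rsqr; simpl; ring.
Qed.

Lemma vnorm_vsum f l : vnorm (vsum f l) <= rsum (fun m => vnorm (f m)) l.
Proof.
  induction l as [|m l IH]; simpl.
  - unfold vnorm, dot, vzero; simpl; rewrite Rmult_0_l, Rplus_0_l, sqrt_0; lra.
  - assert (H := vnorm_vadd (f m) (vsum f l)); lra.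
Qed.

Definition perp (u : pt) : pt := (- snd u, fst u).

Lemma dot_perp u v : dot (perp u) v = det2 u v.
Proof. unfold dot, perp, det2; simpl; ring. Qed.

Lemma perp_decomp u v : dot u u = 1 -> dot v u = 0 -> v = vscale (dot v (perp u)) (perp u).
Proof.
  destruct u as [a b], v as [c d]; unfold dot, perp, vscale; simpl; intros H1 H2.
  apply pt_eq; simpl.
  - assert (c * (a * a + b * b) = a * (c * a + d * b) + (c * b - d * a) * b) by ring.
    rewrite H1, H2 in H; lra.
  - assert (d * (a * a + b * b) = b * (c * a + d * b) + (d * a - c * b) * a) by ring.
    rewrite H1, H2 in H; lra.
Qed.

Lemma solve_dots u v a b : det2 u v <> 0 -> exists x, dot x u = a /\ dot x v = b.
Proof.
  intros H.
  exists ((a * snd v - b * snd u) / det2 u v, (b * fst u - a * fst v) / det2 u v).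
  unfold dot, det2 in *; simpl; split; field; exact H.
Qed.

Lemma dots_eq0 u v x : det2 u v <> 0 -> dot x u = 0 -> dot x v = 0 -> x = vzero.
Proof.
  unfold dot, det2; intros H H1 H2; apply pt_eq; simpl;
    apply Rmult_eq_reg_r with (fst u * snd v - snd u * fst v); trivial.
  - transitivity ((fst x * fst u + snd x * snd u) * snd v
                  - (fst x * fst v + snd x * snd v) * snd u); [ring|rewrite H1, H2; ring].
  - transitivity ((fst x * fst v + snd x * snd v) * fst u
                  - (fst x * fst u + snd x * snd u) * fst v); [ring|rewrite H1, H2; ring].
Qed.

(** * The filled-in graph of the ceiling function *)

(** Since [up t] is the limit of [ceilZ] at [t] from the right, the fibre over [t] is the segment
    from [t] to [t + 1] at an integer and a single point elsewhere. *)
Definition filled (t y : R) : Prop := IZR (ceilZ t) <= y <= IZR (up t).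
(** A step function that gains one half on reaching an integer and another half on leaving it, so
    that a line through an endpoint counts one half. *)
Definition midceil (t : R) : R := (IZR (ceilZ t) + IZR (up t)) / 2.
Definition jump (t : R) : R := IZR (up t) - IZR (ceilZ t).

Lemma ceilZ_spec t : IZR (ceilZ t) - 1 < t <= IZR (ceilZ t).
Proof. unfold ceilZ; rewrite minus_IZR; destruct (archimed (- t)); lra. Qed.

Lemma ceilZ_unique t z : IZR z - 1 < t <= IZR z -> ceilZ t = z.
Proof.
  intros H; assert (Hc := ceilZ_spec t).
  assert (IZR (ceilZ t) < IZR (z + 1)) by (rewrite plus_IZR; lra).
  assert (IZR z < IZR (ceilZ t + 1)) by (rewrite plus_IZR; lra).
  apply lt_IZR in H0, H1; lia.
Qed.

Lemma jump_int t : is_int t -> jump t = 1.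
Proof.
  intros [z ->]; unfold jump.
  rewrite (ceilZ_unique _ z), <- (tech_up _ (z + 1)); rewrite ?plus_IZR; lra.
Qed.

Lemma jump_nonint t : ~ is_int t -> jump t = 0.
Proof.
  intros H; unfold jump.
  assert (Hc := ceilZ_spec t).
  rewrite <- (tech_up t (ceilZ t)); [ring| |lra].
  destruct (Rlt_dec t (IZR (ceilZ t))) as [|Hn]; trivial.
  exfalso; apply H; exists (ceilZ t); lra.
Qed.

Lemma jump_cases t : is_int t /\ jump t = 1 \/ ~ is_int t /\ jump t = 0.
Proof.
  destruct (classic (is_int t)); [left|right]; split; trivial;
    [now apply jump_int|now apply jump_nonint].
Qed.

Lemma filled_ceilZ t : filled t (IZR (ceilZ t)).
Proof. unfold filled; assert (H := jump_cases t); unfold jump in H; lra. Qed.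

Lemma filled_dist t y : filled t y -> Rabs (y - t) <= 1.
Proof.
  unfold filled; intros H; assert (Hc := ceilZ_spec t); destruct (archimed t).
  apply Rabs_le; lra.
Qed.

Lemma up_le_ceilZ s t : s < t -> IZR (up s) <= IZR (ceilZ t).
Proof.
  intros H; assert (Hc := ceilZ_spec t); destruct (archimed s).
  apply IZR_le; assert (IZR (up s) < IZR (ceilZ t + 1)) by (rewrite plus_IZR; lra).
  apply lt_IZR in H2; lia.
Qed.

Lemma ceilZ_le_up s t : t <= IZR (up s) -> IZR (ceilZ t) <= IZR (up s).
Proof.
  intros H; assert (Hc := ceilZ_spec t).
  apply IZR_le; assert (IZR (ceilZ t) < IZR (up s + 1)) by (rewrite plus_IZR; lra).
  apply lt_IZR in H0; lia.
Qed.

Lemma filled_monotone s t y z : filled s y -> filled t z -> 0 <= (y - z) * (s - t).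
Proof.
  unfold filled; intros Hy Hz; destruct (Rtotal_order s t) as [H|[->|H]].
  - assert (H1 := up_le_ceilZ s t H); nra.
  - lra.
  - assert (H1 := up_le_ceilZ t s H); nra.
Qed.

(** Fibres over different arguments are ordered and share at most an endpoint, and the fibre over a
    non-integer is a point. *)
Lemma filled_meet s t y z : s <> t \/ ~ is_int s ->
  filled s y -> filled t y -> filled s z -> filled t z -> y = z.
Proof.
  intros H; unfold filled; intros.
  destruct (Rtotal_order s t) as [H4|[<-|H4]].
  - assert (H5 := up_le_ceilZ s t H4); lra.
  - destruct H as [H|H]; [lra|].
    assert (H5 := jump_nonint s H); unfold jump in H5; lra.
  - assert (H5 := up_le_ceilZ t s H4); lra.
Qed.

(** Two such fibres can only touch at an endpoint of each, so their midpoints are half the sum of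
    their lengths apart. *)
Lemma midceil_meet s t y : s <> t -> filled s y -> filled t y ->
  Rabs (midceil s - midceil t) = (jump s + jump t) / 2.
Proof.
  intros H; unfold filled, midceil, jump; intros.
  assert (Hs := jump_cases s); assert (Ht := jump_cases t); unfold jump in *.
  destruct (Rtotal_order s t) as [H4|[H4|H4]]; [|lra|].
  - assert (H5 := up_le_ceilZ s t H4).
    rewrite Rabs_left1; lra.
  - assert (H5 := up_le_ceilZ t s H4).
    rewrite Rabs_right; lra.
Qed.

Lemma midceil_ge s t : s <> t ->
  (jump s + jump t) / 2 <= Rabs (midceil s - midceil t).
Proof.
  intros H; unfold midceil, jump.
  assert (Hs := jump_cases s); assert (Ht := jump_cases t); unfold jump in *.
  destruct (Rtotal_order s t) as [H4|[H4|H4]]; [|lra|].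
  - assert (H5 := up_le_ceilZ s t H4).
    rewrite Rabs_left1; lra.
  - assert (H5 := up_le_ceilZ t s H4).
    rewrite Rabs_right; lra.
Qed.

Lemma midceil_monotone s t : s <= t -> midceil s <= midceil t.
Proof.
  intros [H| ->]; [|lra]; unfold midceil.
  assert (H5 := up_le_ceilZ s t H).
  assert (Hs := jump_cases s); assert (Ht := jump_cases t); unfold jump in *; lra.
Qed.

(** Monotonicity turns the triangle inequality into an equality; this makes [sep] additive along
    segments. *)
Lemma midceil_between s t lam : 0 <= lam <= 1 ->
  let r := (1 - lam) * s + lam * t in
  Rabs (midceil s - midceil t) = Rabs (midceil s - midceil r) + Rabs (midceil r - midceil t).
Proof.
  intros H r; destruct (Rle_dec s t) as [Hst|Hst].
  - assert (H1 : s <= r <= t) by (unfold r; split; nra).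
    assert (midceil s <= midceil r) by now apply midceil_monotone.
    assert (midceil r <= midceil t) by now apply midceil_monotone.
    rewrite !Rabs_left1; lra.
  - assert (H1 : t <= r <= s) by (unfold r; split; nra).
    assert (midceil t <= midceil r) by now apply midceil_monotone.
    assert (midceil r <= midceil s) by now apply midceil_monotone.
    rewrite !Rabs_right; lra.
Qed.

Lemma midceil_dist s t : -1 <= Rabs (midceil s - midceil t) - Rabs (s - t) <= 1.
Proof.
  assert (Hc := ceilZ_spec s); assert (Hc' := ceilZ_spec t).
  assert (Hs := jump_cases s); assert (Ht := jump_cases t); unfold jump in *.
  (* The shift by 1/2 cancels in differences, and two errors of at most 1/2 add up to at most
     one. *)
  assert (Hd : forall x, -1/2 <= midceil x - x - 1/2 <= 1/2).
  { intros x; unfold midceil; assert (H1 := ceilZ_spec x); destruct (archimed x); lra. }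
  assert (H1 := Hd s); assert (H2 := Hd t).
  unfold Rabs; repeat destruct Rcase_abs; lra.
Qed.

Lemma int_between s t : s < t -> (forall z, ~ s < IZR z < t) ->
  filled s (IZR (up s)) /\ filled t (IZR (up s)).
Proof.
  intros H Hz; unfold filled.
  assert (Hs := jump_cases s); assert (Ht := jump_cases t); unfold jump in *.
  assert (H1 := up_le_ceilZ s t H).
  assert (t <= IZR (up s)).
  { apply Rnot_lt_le; intros H2; apply (Hz (up s)); destruct (archimed s); lra. }
  assert (H2 := ceilZ_le_up s t H0); lra.
Qed.

(** Both one-sided limits of [ceilZ] at [t] lie in the fibre over [t]; this puts the images of the
    cells around a point into its zonotope. *)
Lemma filled_nbhd t : exists e, 0 < e /\
  forall s, Rabs (s - t) < e -> filled t (IZR (ceilZ s)).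
Proof.
  assert (Hc := ceilZ_spec t); destruct (archimed t) as [Ha Hb].
  exists (Rmin (t - (IZR (ceilZ t) - 1)) (IZR (up t) - t)); split.
  - apply Rmin_pos; lra.
  - intros s Hs.
    assert (H1 := Rmin_l (t - (IZR (ceilZ t) - 1)) (IZR (up t) - t)).
    assert (H2 := Rmin_r (t - (IZR (ceilZ t) - 1)) (IZR (up t) - t)).
    apply Rabs_def2 in Hs; assert (Hs' := ceilZ_spec s).
    split; [|apply ceilZ_le_up; lra].
    apply IZR_le.
    assert (IZR (ceilZ t) < IZR (ceilZ s + 1)) by (rewrite plus_IZR; lra).
    apply lt_IZR in H; lia.
Qed.

Lemma ceilZ_nbhd t : ~ is_int t -> exists e, 0 < e /\
  forall s, Rabs (s - t) < e -> ~ is_int s /\ ceilZ s = ceilZ t.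
Proof.
  intros Hn; assert (Hc := ceilZ_spec t).
  assert (Hlt : t < IZR (ceilZ t)).
  { destruct (Rlt_dec t (IZR (ceilZ t))); trivial.
    exfalso; apply Hn; exists (ceilZ t); lra. }
  exists (Rmin (t - (IZR (ceilZ t) - 1)) (IZR (ceilZ t) - t)); split.
  - apply Rmin_pos; lra.
  - intros s Hs.
    assert (H1 := Rmin_l (t - (IZR (ceilZ t) - 1)) (IZR (ceilZ t) - t)).
    assert (H2 := Rmin_r (t - (IZR (ceilZ t) - 1)) (IZR (ceilZ t) - t)).
    apply Rabs_def2 in Hs; split.
    + intros [z ->].
      assert (IZR (ceilZ t - 1) < IZR z) by (rewrite minus_IZR; lra).
      assert (IZR z < IZR (ceilZ t)) by lra.
      apply lt_IZR in H, H0; lia.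
    + apply ceilZ_unique; lra.
Qed.

(** * Grids and their tiles *)

Section Grid.

Variables (N : nat) (g : nat -> pt) (gam : nat -> R).
Hypothesis hunit : forall i, (i < N)%nat -> vnorm (g i) = 1.
Hypothesis hnonpar : forall i j, (i < N)%nat -> (j < N)%nat -> i <> j -> det2 (g i) (g j) <> 0.
Hypothesis hreg : regular_grid N g gam.

Definition comb (y : nat -> R) : pt := vsum (fun m => vscale (y m) (g m)) (seq 0 N).
Definition level (m : nat) (p : pt) : R := dot p (g m) - gam m.
(** A translate of the Minkowski sum of the segments from 0 to [g m] over the families [m] with a
    line through [p]. For a grid vertex it coincides with the tile. *)
Definition zonotope (p v : pt) : Prop :=
  exists y, (forall m, (m < N)%nat -> filled (level m p) (y m)) /\ v = comb y.
Definition sep (p q : pt) : R :=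
  rsum (fun m => Rabs (midceil (level m p) - midceil (level m q))) (seq 0 N).
Definition gnorm (v : pt) : R := rsum (fun m => Rabs (dot v (g m))) (seq 0 N).

Lemma in_seq0 m : In m (seq 0 N) <-> (m < N)%nat.
Proof. rewrite in_seq; lia. Qed.

Lemma comb_ext y z : (forall m, (m < N)%nat -> y m = z m) -> comb y = comb z.
Proof.
  intros H; apply pt_eq; unfold comb; rewrite ?fst_vsum, ?snd_vsum;
    apply rsum_ext; intros m Hm%in_seq0; now rewrite H.
Qed.

Lemma comb_lin a y z :
  vadd (vscale a (comb y)) (comb z) = comb (fun m => a * y m + z m).
Proof.
  apply pt_eq; unfold comb, vadd, vscale; cbn [fst snd];
    rewrite ?fst_vsum, ?snd_vsum, <- rsum_scal, <- rsum_plus;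
    apply rsum_ext; intros; cbn [fst snd]; ring.
Qed.

Lemma comb_lin2 a b y z :
  vadd (vscale a (comb y)) (vscale b (comb z)) = comb (fun m => a * y m + b * z m).
Proof.
  apply pt_eq; unfold comb, vadd, vscale; cbn [fst snd];
    rewrite ?fst_vsum, ?snd_vsum, <- !rsum_scal, <- rsum_plus;
    apply rsum_ext; intros; cbn [fst snd]; ring.
Qed.

Lemma comb_zero : comb (fun _ => 0) = vzero.
Proof.
  apply pt_eq; unfold comb; rewrite ?fst_vsum, ?snd_vsum;
    apply rsum_zero; intros; simpl; ring.
Qed.

Lemma comb_sub y z : vsub (comb y) (comb z) = comb (fun m => y m - z m).
Proof.
  apply pt_eq; unfold comb, vsub, vadd, vscale; cbn [fst snd];
    rewrite ?fst_vsum, ?snd_vsum, <- rsum_scal, <- rsum_plus;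
    apply rsum_ext; intros; cbn [fst snd]; ring.
Qed.

Lemma dot_comb y x : dot (comb y) x = rsum (fun m => y m * dot x (g m)) (seq 0 N).
Proof.
  unfold dot at 1, comb; rewrite fst_vsum, snd_vsum.
  rewrite Rmult_comm, (Rmult_comm (rsum _ _) (snd x)), <- !rsum_scal, <- rsum_plus.
  apply rsum_ext; intros; unfold dot, vscale; cbn [fst snd]; ring.
Qed.

Lemma vnorm_comb y : vnorm (comb y) <= rsum (fun m => Rabs (y m)) (seq 0 N).
Proof.
  apply Rle_trans with (1 := vnorm_vsum _ _), rsum_le.
  intros m Hm%in_seq0; rewrite vnorm_vscale, hunit by trivial; lra.
Qed.

Lemma dot_g_le v m : (m < N)%nat -> Rabs (dot v (g m)) <= vnorm v.
Proof.
  intros Hm; assert (H := dot_le_vnorm v (g m)).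
  rewrite hunit in H by trivial; lra.
Qed.

Lemma level_sub m p q : level m p - level m q = dot (vsub p q) (g m).
Proof. rewrite dot_vsub; unfold level; ring. Qed.

(** * Tiles as zonotopes *)

Lemma cell_image_zonotope p v : cell_image_at N g gam p v -> zonotope p v.
Proof.
  intros Hv.
  destruct (common_radius
    (fun m e => forall s, Rabs (s - level m p) < e -> filled (level m p) (IZR (ceilZ s))) N)
    as [e [He Hf]].
  - intros m e e' H [_ He'] s Hs; apply H; lra.
  - intros m _; apply filled_nbhd.
  - destruct (Hv e He) as [y [Hy [_ <-]]].
    exists (fun m => IZR (ceilZ (level m y))); split; [|reflexivity].
    intros m Hm; apply Hf; trivial.
    rewrite level_sub; assert (H := dot_g_le (vsub y p) m Hm); unfold Defs.dist in Hy; lra.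
Qed.

Lemma tile_zonotope p v : tile_at N g gam p v -> zonotope p v.
Proof.
  intros [l [Hl [Hw ->]]].
  (* Tails of the list have arbitrary total weight, so the induction bounds the coefficients by that
     weight times the ends of the fibre; the weight becomes one only afterwards. *)
  assert (H : exists y, (forall m, (m < N)%nat ->
      let w := fold_right (fun wp acc => fst wp + acc) 0 l in
      w * IZR (ceilZ (level m p)) <= y m <= w * IZR (up (level m p))) /\
    fold_right (fun wp acc => vadd (vscale (fst wp) (snd wp)) acc) vzero l = comb y).
  { clear Hw; induction l as [|[w u] l IH]; simpl.
    - exists (fun _ => 0); split; [intros; lra|now rewrite comb_zero].
    - apply Forall_cons_iff in Hl as [[Hw Hu] Hl]; simpl in Hw, Hu.
      destruct (IH Hl) as [y [Hy ->]].
      destruct (cell_image_zonotope p u Hu) as [z [Hz ->]].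
      exists (fun m => w * z m + y m); split; [|apply comb_lin].
      intros m Hm; specialize (Hy m Hm); destruct (Hz m Hm); simpl in Hy.
      assert (w * IZR (ceilZ (level m p)) <= w * z m) by now apply Rmult_le_compat_l.
      assert (w * z m <= w * IZR (up (level m p))) by now apply Rmult_le_compat_l.
      rewrite !Rmult_plus_distr_r; lra. }
  destruct H as [y [Hy ->]]; exists y; split; [|reflexivity].
  intros m Hm; specialize (Hy m Hm); rewrite Hw in Hy; unfold filled; lra.
Qed.

(** The flag [a] picks the side: leaving an integer downwards keeps the ceiling, leaving it upwards
    raises it by one. *)
Lemma ceilZ_shift t a eta : is_int t -> a = 0 \/ a = 1 -> 0 < eta < 1 ->
  ~ is_int (t + eta * (2 * a - 1)) /\
  IZR (ceilZ (t + eta * (2 * a - 1))) = IZR (ceilZ t) + a.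
Proof.
  intros [z ->] Ha Heta; split.
  - intros [k Hk].
    destruct Ha; subst a.
    + assert (IZR (z - 1) < IZR k) by (rewrite minus_IZR; lra).
      assert (IZR k < IZR z) by lra.
      apply lt_IZR in H, H0; lia.
    + assert (IZR z < IZR k) by lra.
      assert (IZR k < IZR (z + 1)) by (rewrite plus_IZR; lra).
      apply lt_IZR in H, H0; lia.
  - rewrite (ceilZ_unique (IZR z) z) by lra.
    destruct Ha; subst a.
    + rewrite (ceilZ_unique _ z); lra.
    + rewrite (ceilZ_unique _ (z + 1)); rewrite plus_IZR; lra.
Qed.

Definition on_pair i j p : Prop :=
  (i < N)%nat /\ (j < N)%nat /\ i <> j /\ is_int (level i p) /\ is_int (level j p).

Lemma on_pair_vertex i j p : on_pair i j p -> grid_vertex N g gam p.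
Proof. intros H; exists i, j; exact H. Qed.

(** Regularity enters here: no third family has a line through a crossing of families [i] and
    [j]. *)
Lemma on_pair_nonint i j p m : on_pair i j p -> (m < N)%nat -> m <> i -> m <> j ->
  ~ is_int (level m p).
Proof.
  intros [Hi [Hj [Hij [H1 H2]]]] Hm Hmi Hmj H3.
  apply (hreg p i j m); trivial; [congruence|congruence|].
  now repeat split.
Qed.

Lemma vertex_jumps p : grid_vertex N g gam p ->
  rsum (fun m => jump (level m p)) (seq 0 N) = 2.
Proof.
  intros [i [j H]]; assert (Hij : on_pair i j p) by exact H.
  clear H; assert (Hij2 := Hij); destruct Hij2 as [Hi [Hj [Hne [H1 H2]]]].
  rewrite (rsum_two _ _ i j); trivial; try now apply in_seq0.
  - rewrite !jump_int; trivial; ring.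
  - apply seq_NoDup.
  - intros m Hm%in_seq0 Hmi Hmj; apply jump_nonint, (on_pair_nonint i j); trivial.
Qed.

(** The flags [a] and [b] choose a side of each of the two lines through [p]; the four choices of 0
    or 1 give the coefficients of the vertices of the rhombus. *)
Definition corner (i j : nat) (p : pt) (a b : R) (m : nat) : R :=
  IZR (ceilZ (level m p)) + (if Nat.eq_dec m i then a else 0)
  + (if Nat.eq_dec m j then b else 0).

Lemma corner_cell_image i j p a b : on_pair i j p -> a = 0 \/ a = 1 -> b = 0 \/ b = 1 ->
  cell_image_at N g gam p (comb (corner i j p a b)).
Proof.
  intros Hp Ha Hb eps Heps.
  assert (Hp' := Hp); destruct Hp' as [Hi [Hj [Hij [H1 H2]]]].
  (* Moving along [w] leaves the two lines on the sides prescribed by [a] and [b], since [2 * a - 1]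
     and [2 * b - 1] are signs. *)
  destruct (solve_dots (g i) (g j) (2 * a - 1) (2 * b - 1)) as [w [Hwi Hwj]];
    [now apply hnonpar|].
  destruct (common_radius
    (fun m e => m <> i -> m <> j -> forall s, Rabs (s - level m p) < e ->
       ~ is_int s /\ ceilZ s = ceilZ (level m p)) N) as [e [He Hf]].
  { intros m e e' H [_ He'] Hmi Hmj s Hs; apply H; trivial; lra. }
  { intros m Hm.
    destruct (classic (m <> i /\ m <> j)) as [[Hmi Hmj]|Hn].
    - destruct (ceilZ_nbhd (level m p)) as [e [He H]].
      + now apply (on_pair_nonint i j).
      + exists e; split; trivial; intros _ _; exact H.
    - exists 1; split; [lra|]; intros; exfalso; apply Hn; now split. }
  set (del := Rmin (Rmin eps e) 1).
  assert (Hdel : 0 < del) by (repeat apply Rmin_pos; lra).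
  assert (Hd1 : del <= 1) by apply Rmin_r.
  assert (Hde : del <= Rmin eps e) by apply Rmin_l.
  assert (Hd2 := Rmin_l eps e); assert (Hd3 := Rmin_r eps e).
  assert (Hw := vnorm_pos w).
  (* The summand 1 in the denominator keeps it positive and also forces [eta < 1], as [ceilZ_shift]
     requires; the displacement stays below [del]. *)
  set (eta := del / 2 / (1 + vnorm w)).
  assert (Heta : eta * (1 + vnorm w) = del / 2) by (unfold eta; field; lra).
  assert (Heta0 : 0 < eta) by (unfold eta; apply Rdiv_lt_0_compat; lra).
  assert (Heta1 : eta < 1) by nra.
  assert (Hnear : Defs.dist (vadd p (vscale eta w)) p < del).
  { unfold Defs.dist; replace (vsub (vadd p (vscale eta w)) p) with (vscale eta w) by pt_ring.
    rewrite vnorm_vscale, Rabs_right by lra; lra. }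
  set (y := vadd p (vscale eta w)) in *.
  assert (Hlev : forall m, level m y = level m p + eta * dot w (g m)).
  { intros m; unfold level, y; rewrite dot_vadd, dot_vscale; ring. }
  assert (Hy : forall m, (m < N)%nat ->
    ~ is_int (level m y) /\ IZR (ceilZ (level m y)) = corner i j p a b m).
  { intros m Hm; unfold corner.
    destruct (Nat.eq_dec m i) as [->|Hmi].
    - destruct (Nat.eq_dec i j) as [|_]; [contradiction|].
      rewrite Hlev, Hwi, Rplus_0_r; apply ceilZ_shift; trivial; lra.
    - destruct (Nat.eq_dec m j) as [->|Hmj].
      + rewrite Hlev, Hwj, Rplus_0_r; apply ceilZ_shift; trivial; lra.
      + destruct (Hf m Hm Hmi Hmj (level m y)) as [H3 ->].
        * rewrite level_sub; assert (H := dot_g_le (vsub y p) m Hm).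
          unfold Defs.dist in Hnear; lra.
        * split; trivial; ring. }
  exists y; split; [lra|split].
  - intros [m [Hm Hg]]; now apply (Hy m Hm).
  - apply comb_ext; intros m Hm; now apply (Hy m Hm).
Qed.

Lemma zonotope_tile p v : grid_vertex N g gam p -> zonotope p v -> tile_at N g gam p v.
Proof.
  intros [i [j H]] [y [Hy ->]]; assert (Hp : on_pair i j p) by exact H.
  clear H; assert (Hp2 := Hp); destruct Hp2 as [Hi [Hj [Hij [H1 H2]]]].
  assert (Hs := Hy i Hi); assert (Ht := Hy j Hj).
  unfold filled in Hs, Ht; apply jump_int in H1, H2; unfold jump in H1, H2.
  (* These are the coordinates of the point within the rhombus; the bilinear weights formed from
     them sum to one. *)
  set (s := y i - IZR (ceilZ (level i p))); set (t := y j - IZR (ceilZ (level j p))).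
  exists (((1 - s) * (1 - t), comb (corner i j p 0 0))
       :: (s * (1 - t), comb (corner i j p 1 0))
       :: ((1 - s) * t, comb (corner i j p 0 1))
       :: (s * t, comb (corner i j p 1 1)) :: nil).
  assert (Hs' : 0 <= s <= 1) by (unfold s; lra).
  assert (Ht' : 0 <= t <= 1) by (unfold t; lra).
  split; [|split].
  - repeat (apply Forall_cons; [split; cbn [fst snd]|]); try apply Forall_nil;
      try (apply corner_cell_image; auto); apply Rmult_le_pos; lra.
  - simpl; ring.
  - cbn [fold_right fst snd]; rewrite <- comb_zero, !comb_lin.
    apply comb_ext; intros m Hm; unfold corner.
    destruct (Nat.eq_dec m i) as [->|Hmi]; [|destruct (Nat.eq_dec m j) as [->|Hmj]].
    + destruct (Nat.eq_dec i j) as [|_]; [contradiction|]; unfold s; ring.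
    + unfold t; ring.
    + assert (H3 := on_pair_nonint i j p m Hp Hm Hmi Hmj).
      assert (H4 := Hy m Hm); apply jump_nonint in H3; unfold filled, jump in *.
      replace (y m) with (IZR (ceilZ (level m p))) by lra; ring.
Qed.

(* Expanding [(comb y - comb z, p - q) = 0] gives a vanishing sum of terms that
   are nonnegative by monotonicity. *)
Lemma zonotope_common p q y z :
  (forall m, (m < N)%nat -> filled (level m p) (y m)) ->
  (forall m, (m < N)%nat -> filled (level m q) (z m)) ->
  comb y = comb z ->
  forall m, (m < N)%nat -> level m p <> level m q -> y m = z m.
Proof.
  intros Hy Hz E m Hm Hne.
  assert (H : (y m - z m) * (level m p - level m q) = 0).
  { apply (rsum_nonneg_eq0 (fun m => (y m - z m) * (level m p - level m q)) (seq 0 N)).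
    - intros k Hk%in_seq0; apply filled_monotone; auto.
    - rewrite (rsum_ext _ (fun k => (y k - z k) * dot (vsub p q) (g k))).
      + rewrite <- dot_comb, <- comb_sub, E; unfold dot, vsub, vadd, vscale; simpl; ring.
      + intros; now rewrite level_sub.
    - now apply in_seq0. }
  apply Rmult_integral in H as [H|H]; lra.
Qed.

(** * Separation of vertices and adjacency of tiles *)

Lemma rsum_indicator k : (k < N)%nat ->
  rsum (fun m => if Nat.eq_dec m k then 1 else 0) (seq 0 N) = 1.
Proof.
  intros Hk; rewrite (rsum_single _ _ k).
  - now destruct (Nat.eq_dec k k).
  - apply seq_NoDup.
  - now apply in_seq0.
  - intros m _ Hm; now destruct (Nat.eq_dec m k).
Qed.

(** If a grid line contains both [p] and [q], each family with unequal levels contributes exactly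
    half the sum of its jumps; all jumps together give (2 + 2) / 2, and the common line takes off 1.
    Otherwise a common point of the tiles has all its coefficients determined, so no segment is
    shared. *)
Lemma neighbours_sep p q : grid_vertex N g gam p -> grid_vertex N g gam q ->
  neighbours (tile_at N g gam p) (tile_at N g gam q) -> sep p q <= 1.
Proof.
  intros Hp Hq [a [b [Hab Hseg]]].
  destruct (Hseg a) as [Ha Ha']; [exists 0; split; [lra|pt_ring]|].
  destruct (Hseg b) as [Hb Hb']; [exists 1; split; [lra|pt_ring]|].
  apply tile_zonotope in Ha as [y [Hy ->]], Ha' as [y' [Hy' Ey]],
    Hb as [z [Hz ->]], Hb' as [z' [Hz' Ez]].
  assert (E1 := zonotope_common p q y y' Hy Hy' Ey).
  assert (E2 := zonotope_common p q z z' Hz Hz' Ez).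
  destruct (classic (exists k, (k < N)%nat /\ level k p = level k q /\ is_int (level k p)))
    as [[k [Hk [Ek Hint]]]|Hno].
  - apply Rle_trans with (rsum (fun m => / 2 * (jump (level m p) + jump (level m q))
        + (-1) * (if Nat.eq_dec m k then 1 else 0)) (seq 0 N)).
    + apply rsum_le; intros m Hm%in_seq0.
      assert (Hjp := jump_cases (level m p)); assert (Hjq := jump_cases (level m q)).
      destruct (Req_dec (level m p) (level m q)) as [E|E].
      * rewrite E, Rminus_diag, Rabs_R0 in *.
        destruct (Nat.eq_dec m k) as [->|]; [|lra].
        rewrite E in Hint; rewrite (jump_int _ Hint); lra.
      * destruct (Nat.eq_dec m k) as [->|]; [contradiction|].
        rewrite (midceil_meet _ _ (y m)); trivial; [lra|auto|].
        rewrite E1; auto.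
    + rewrite rsum_plus, !rsum_scal, rsum_plus, !vertex_jumps, rsum_indicator; trivial; lra.
  - exfalso; apply Hab, comb_ext; intros m Hm.
    destruct (Req_dec (level m p) (level m q)) as [E|E].
    + apply (filled_meet (level m p) (level m p)); auto.
      right; intros H; apply Hno; now exists m.
    + apply (filled_meet (level m p) (level m q)); auto.
      * rewrite E1; auto.
      * rewrite E2; auto.
Qed.

(** The count of [neighbours_sep] read from below: distinct points of one line of family [i] have
    different levels in every other family, which then contributes at least half its jumps. *)
Lemma sep_ge_1 i p q : grid_vertex N g gam p -> grid_vertex N g gam q ->
  (i < N)%nat -> is_int (level i p) -> level i p = level i q -> p <> q -> 1 <= sep p q.
Proof.
  intros Hp Hq Hi Hint E Hne.
  apply Rle_trans with (rsum (fun m => / 2 * (jump (level m p) + jump (level m q))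
        + (-1) * (if Nat.eq_dec m i then 1 else 0)) (seq 0 N)).
  - rewrite rsum_plus, !rsum_scal, rsum_plus, !vertex_jumps, rsum_indicator; trivial; lra.
  - apply rsum_le; intros m Hm%in_seq0.
    destruct (Nat.eq_dec m i) as [->|Hmi].
    + rewrite <- E, Rminus_diag, Rabs_R0, (jump_int _ Hint); lra.
    + assert (Hm' : level m p <> level m q).
      { intros E'; apply Hne, vsub_eq0, (dots_eq0 (g i) (g m)).
        - apply hnonpar; auto.
        - rewrite <- level_sub; lra.
        - rewrite <- level_sub; lra. }
      assert (H := midceil_ge _ _ Hm'); lra.
Qed.

Lemma sep_triangle p q r : sep p r <= sep p q + sep q r.
Proof.
  unfold sep; rewrite <- rsum_plus; apply rsum_le; intros m _.
  replace (midceil (level m p) - midceil (level m r))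
    with ((midceil (level m p) - midceil (level m q))
          + (midceil (level m q) - midceil (level m r))) by ring.
  apply Rabs_triang.
Qed.

(** * The norm [gnorm] and its comparison with [sep] *)

Lemma gnorm_nonneg v : 0 <= gnorm v.
Proof. apply rsum_nonneg; intros; apply Rabs_pos. Qed.

Lemma gnorm_vadd u v : gnorm (vadd u v) <= gnorm u + gnorm v.
Proof.
  unfold gnorm; rewrite <- rsum_plus; apply rsum_le; intros m _.
  rewrite dot_vadd; apply Rabs_triang.
Qed.

Lemma gnorm_vscale a v : gnorm (vscale a v) = Rabs a * gnorm v.
Proof.
  unfold gnorm; rewrite <- rsum_scal; apply rsum_ext; intros m _.
  rewrite dot_vscale; apply Rabs_mult.
Qed.

Lemma gnorm_le_vnorm v : gnorm v <= INR N * vnorm v.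
Proof.
  rewrite <- (length_seq N 0) at 1; rewrite <- rsum_const.
  apply rsum_le; intros m Hm%in_seq0; now apply dot_g_le.
Qed.

Lemma dot_le_gnorm v m : (m < N)%nat -> Rabs (dot v (g m)) <= gnorm v.
Proof.
  intros Hm; apply (rsum_term_le (fun m => Rabs (dot v (g m))));
    [intros; apply Rabs_pos|now apply in_seq0].
Qed.

Lemma sep_gnorm p q : Rabs (sep p q - gnorm (vsub p q)) <= INR N.
Proof.
  assert (H1 : sep p q <= gnorm (vsub p q) + INR N).
  { rewrite <- (Rmult_1_r (INR N)), <- (length_seq N 0) at 1; rewrite <- rsum_const.
    unfold gnorm; rewrite <- rsum_plus; apply rsum_le; intros m _.
    assert (H := midceil_dist (level m p) (level m q)).
    rewrite <- level_sub; lra. }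
  assert (H2 : gnorm (vsub p q) <= sep p q + INR N).
  { rewrite <- (Rmult_1_r (INR N)), <- (length_seq N 0) at 1; rewrite <- rsum_const.
    unfold sep; rewrite <- rsum_plus; apply rsum_le; intros m _.
    assert (H := midceil_dist (level m p) (level m q)).
    rewrite <- level_sub; lra. }
  apply Rabs_le; lra.
Qed.

Lemma consecutive_neighbours i p q : grid_vertex N g gam p -> grid_vertex N g gam q ->
  (i < N)%nat -> is_int (level i p) -> level i p = level i q ->
  (forall m z, (m < N)%nat -> ~ level m p < IZR z < level m q /\ ~ level m q < IZR z < level m p) ->
  neighbours (tile_at N g gam p) (tile_at N g gam q).
Proof.
  intros Hp Hq Hi Hint E Hcons.
  (* The common edge: the coefficient of [g i] runs through the fibre over the shared integer level,
     and every other coefficient is fixed at a value in both fibres, which exists because no integer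
     lies strictly between the two levels. *)
  set (y := fun (s : R) m => if Nat.eq_dec m i then IZR (ceilZ (level i p)) + s else
     if Rlt_dec (level m p) (level m q) then IZR (up (level m p)) else
     if Rlt_dec (level m q) (level m p) then IZR (up (level m q)) else
     IZR (ceilZ (level m p))).
  assert (Hy : forall s, 0 <= s <= 1 -> forall m, (m < N)%nat ->
    filled (level m p) (y s m) /\ filled (level m q) (y s m)).
  { intros s Hs m Hm; unfold y.
    destruct (Nat.eq_dec m i) as [->|_].
    - rewrite <- E; apply jump_int in Hint; unfold jump in Hint; unfold filled; lra.
    - destruct (Rlt_dec (level m p) (level m q)) as [H|H].
      + apply int_between; trivial; intros z; now apply Hcons.
      + destruct (Rlt_dec (level m q) (level m p)) as [H'|H'].
        * apply and_comm, int_between; trivial; intros z; now apply Hcons.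
        * replace (level m q) with (level m p) by lra; split; apply filled_ceilZ. }
  exists (comb (y 0)), (comb (y 1)); split.
  (* The endpoints differ by [g i], which has length one. *)
  - intros Ey; assert (H : dot (vsub (comb (y 1)) (comb (y 0))) (g i) = 0)
      by (rewrite Ey; unfold dot, vsub, vadd, vscale; simpl; ring).
    rewrite comb_sub, dot_comb, (rsum_single _ _ i) in H.
    + unfold y in H; destruct (Nat.eq_dec i i) as [_|]; [|contradiction].
      assert (H' := vnorm_sqr (g i)); rewrite hunit in H' by trivial; lra.
    + apply seq_NoDup.
    + now apply in_seq0.
    + intros m _ Hm; unfold y; destruct (Nat.eq_dec m i); [contradiction|ring].
  - intros x [t [Ht ->]].
    assert (Ex : vadd (vscale (1 - t) (comb (y 0))) (vscale t (comb (y 1)))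
      = comb (y t)).
    { rewrite comb_lin2; apply comb_ext; intros m _; unfold y.
      destruct (Nat.eq_dec m i); [ring|].
      destruct Rlt_dec; [ring|]; destruct Rlt_dec; ring. }
    rewrite Ex; split; apply zonotope_tile; trivial;
      exists (y t); split; trivial; intros m Hm; now apply Hy.
Qed.

(** * Distances between tiles *)

(** Stated as the extension of arbitrary chains, so that it composes directly; the real bound [r]
    lets estimates by [sep] and [gnorm] be added without rounding. *)
Definition reach (p q : pt) (r : R) : Prop :=
  exists L : nat, INR L <= r /\ forall P0 n,
    chain_from (is_tile N g gam) P0 n (tile_at N g gam p) ->
    chain_from (is_tile N g gam) P0 (n + L) (tile_at N g gam q).

Lemma reach_refl p r : 0 <= r -> reach p p r.
Proof. intros Hr; exists 0%nat; split; [exact Hr|]; intros; now rewrite Nat.add_0_r. Qed.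

Lemma reach_trans p q s r1 r2 : reach p q r1 -> reach q s r2 -> reach p s (r1 + r2).
Proof.
  intros [L1 [H1 H1']] [L2 [H2 H2']]; exists (L1 + L2)%nat.
  rewrite plus_INR; split; [lra|]; intros P0 n Hn.
  rewrite Nat.add_assoc; auto.
Qed.

Lemma reach_mono p q r r' : r <= r' -> reach p q r -> reach p q r'.
Proof. intros Hr [L [H H']]; exists L; split; [lra|exact H']. Qed.

Lemma sep_nonneg p q : 0 <= sep p q.
Proof. apply rsum_nonneg; intros; apply Rabs_pos. Qed.

(** The segment from [p] to [q] runs inside a line of family [i] and crosses line [z] of family [m]
    at a vertex [r]. *)
Lemma intermediate_vertex i p q m z :
  (i < N)%nat -> is_int (level i p) -> level i p = level i q -> (m < N)%nat ->
  level m p < IZR z < level m q \/ level m q < IZR z < level m p ->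
  exists r, grid_vertex N g gam r /\ level i r = level i p /\ p <> r /\ r <> q /\
    sep p q = sep p r + sep r q.
Proof.
  intros Hi Hint E Hm Hz.
  set (t := (IZR z - level m p) / (level m q - level m p)).
  assert (Ht : t * (level m q - level m p) = IZR z - level m p) by (unfold t; field; lra).
  assert (Ht01 : 0 < t < 1) by (destruct Hz; split; nra).
  set (r := vadd (vscale (1 - t) p) (vscale t q)).
  assert (Hr : forall k, level k r = (1 - t) * level k p + t * level k q).
  { intros k; unfold level, r; rewrite dot_vadd, !dot_vscale; ring. }
  assert (Hri : level i r = level i p) by (rewrite Hr, <- E; ring).
  assert (Hrm : level m r = IZR z) by (rewrite Hr; lra).
  exists r; split; [|split; [exact Hri|split; [|split]]].
  - exists i, m; split; [exact Hi|split; [exact Hm|split; [|split]]].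
    + intros ->; lra.
    + change (is_int (level i r)); now rewrite Hri.
    + change (is_int (level m r)); rewrite Hrm; now exists z.
  - intros Epr; rewrite <- Epr in Hrm; lra.
  - intros Eqr; rewrite Eqr in Hrm; lra.
  - unfold sep; rewrite <- rsum_plus; apply rsum_ext; intros k _.
    rewrite Hr; apply midceil_between; lra.
Qed.

(** If a vertex splits the separation additively, both parts are at least 1 by [sep_ge_1], so each
    is at most [INR n] and the induction applies. If none does, the tiles are neighbours and one
    step suffices. *)
Lemma reach_on_line n i p q : grid_vertex N g gam p -> grid_vertex N g gam q ->
  (i < N)%nat -> is_int (level i p) -> level i p = level i q -> sep p q <= INR n ->
  reach p q (sep p q).
Proof.
  revert p q; induction n as [|n IH]; intros p q Hp Hq Hi Hint E Hn;
    (destruct (classic (p = q)) as [->|Hne]; [apply reach_refl, sep_nonneg|]);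
    assert (H1 := sep_ge_1 i p q Hp Hq Hi Hint E Hne); [simpl in Hn; lra|].
  rewrite S_INR in Hn.
  destruct (classic (exists r, grid_vertex N g gam r /\ level i r = level i p /\
    p <> r /\ r <> q /\ sep p q = sep p r + sep r q)) as [[r [Hr [Er [Hpr [Hrq Hs]]]]]|Hno].
  - assert (Hintr : is_int (level i r)) by now rewrite Er.
    assert (H2 := sep_ge_1 i p r Hp Hr Hi Hint (eq_sym Er) Hpr).
    assert (H3 := sep_ge_1 i r q Hr Hq Hi Hintr (eq_trans Er E) Hrq).
    rewrite Hs; apply reach_trans with r; apply IH; trivial; try congruence; lra.
  - exists 1%nat; split; [exact H1|]; intros P0 k Hk.
    rewrite Nat.add_1_r; apply chainS with (tile_at N g gam p); trivial.
    + now exists q.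
    + apply (consecutive_neighbours i); trivial.
      intros m z Hm; split; intros Hz; apply Hno;
        apply (intermediate_vertex i p q m z); auto.
Qed.

Lemma gnorm_vzero : gnorm vzero = 0.
Proof.
  apply rsum_zero; intros m _; transitivity (Rabs 0); [|apply Rabs_R0].
  f_equal; unfold dot, vzero; simpl; ring.
Qed.

Lemma gnorm_vsub_sym u v : gnorm (vsub u v) = gnorm (vsub v u).
Proof.
  apply rsum_ext; intros m _; rewrite !dot_vsub; apply Rabs_minus_sym.
Qed.

Lemma reach_on_line_gnorm i p q : grid_vertex N g gam p -> grid_vertex N g gam q ->
  (i < N)%nat -> is_int (level i p) -> level i p = level i q ->
  reach p q (gnorm (vsub q p) + INR N).
Proof.
  intros Hp Hq Hi Hint E; apply reach_mono with (sep p q).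
  - assert (H := sep_gnorm p q); rewrite gnorm_vsub_sym in H.
    assert (H' := Rle_abs (sep p q - gnorm (vsub q p))); lra.
  - destruct (INR_unbounded (sep p q)) as [n Hn].
    apply (reach_on_line n i); trivial; lra.
Qed.

(** * Paths along two grid lines *)

Lemma vnorm_perp u : vnorm (perp u) = vnorm u.
Proof. unfold vnorm; f_equal; unfold dot, perp; simpl; ring. Qed.

Lemma dot_gg i : (i < N)%nat -> dot (g i) (g i) = 1.
Proof. intros Hi; rewrite <- vnorm_sqr, hunit by trivial; ring. Qed.

(** On the line orthogonal to [g a] both sides are proportional to the length of [v], and the factor
    on the right is nonzero because [g a] and [g i] are not parallel. *)
Lemma gnorm_line_bound : exists K, 0 <= K /\ forall a i v, (a < N)%nat -> (i < N)%nat ->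
  a <> i -> dot v (g a) = 0 -> gnorm v <= K * Rabs (dot v (g i)).
Proof.
  (* The term with [i = a] inverts 0, but its absolute value only enlarges the bound. *)
  destruct (initial_segment_bounded (fun a => rsum (fun i => Rabs (/ det2 (g a) (g i))) (seq 0 N)) N)
    as [K [HK H]].
  exists (INR N * K); split; [apply Rmult_le_pos; [apply pos_INR|exact HK]|].
  intros a i v Ha Hi Hai Hv.
  assert (Hd := hnonpar a i Ha Hi Hai).
  rewrite (perp_decomp (g a) v) by (trivial; now apply dot_gg).
  set (s := dot v (perp (g a))).
  rewrite gnorm_vscale, dot_vscale, dot_perp, Rabs_mult.
  assert (H1 := gnorm_le_vnorm (perp (g a))); rewrite vnorm_perp, hunit in H1 by trivial.
  assert (H2 : Rabs (/ det2 (g a) (g i)) <= K).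
  { apply Rle_trans with (2 := H a Ha).
    apply (rsum_term_le (fun i => Rabs (/ det2 (g a) (g i))));
      [intros; apply Rabs_pos|now apply in_seq0]. }
  rewrite Rabs_inv in H2.
  assert (H3 : 0 < Rabs (det2 (g a) (g i))) by now apply Rabs_pos_lt.
  assert (H4 : 1 <= K * Rabs (det2 (g a) (g i))).
  { apply Rmult_le_compat_r with (r := Rabs (det2 (g a) (g i))) in H2; [|lra].
    rewrite Rinv_l in H2; lra. }
  assert (H5 := Rabs_pos s); assert (H6 := pos_INR N).
  apply Rle_trans with (Rabs s * INR N * 1); [nra|].
  replace (INR N * K * (Rabs s * Rabs (det2 (g a) (g i))))
    with (Rabs s * INR N * (K * Rabs (det2 (g a) (g i)))) by ring.
  apply Rmult_le_compat_l; [nra|exact H4].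
Qed.

(* The two summands point along grid lines bounding a sector free of other grid
   directions; adding a family splits the sector if necessary. *)
Lemma sector_decomp n v : (2 <= n <= N)%nat -> exists i j u w,
  (i < n)%nat /\ (j < n)%nat /\ i <> j /\ v = vadd u w /\
  dot u (g i) = 0 /\ dot w (g j) = 0 /\
  forall m, (m < n)%nat -> 0 <= dot u (g m) * dot w (g m).
Proof.
  induction n as [|n IH]; [lia|]; intros Hn.
  destruct (Nat.eq_dec n 1) as [->|Hn1].
  - destruct (solve_dots (g 0%nat) (g 1%nat) 0 (dot v (g 1%nat))) as [u [H0 H1]];
      [apply hnonpar; lia|].
    exists 0%nat, 1%nat, u, (vsub v u); repeat split; try lia; trivial.
    + pt_ring.
    + rewrite dot_vsub; lra.
    + intros m Hm; assert (Hm' : m = 0%nat \/ m = 1%nat) by lia.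
      destruct Hm' as [->| ->]; rewrite dot_vsub; [rewrite H0|rewrite H1]; nra.
  - destruct IH as [i [j [u [w [Hi [Hj [Hij [-> [Hu [Hw Hs]]]]]]]]]]; [lia|].
    destruct (Rle_dec 0 (dot u (g n) * dot w (g n))) as [Hpos|Hneg].
    + exists i, j, u, w; repeat split; try lia; trivial.
      intros m Hm; destruct (Nat.eq_dec m n) as [->|]; [exact Hpos|apply Hs; lia].
    + apply Rnot_le_lt in Hneg.
      assert (Hsplit : forall k x y, (k < n)%nat -> dot x (g k) = 0 ->
        (forall m, (m < n)%nat -> 0 <= dot x (g m) * dot y (g m)) ->
        dot x (g n) * dot y (g n) < 0 -> Rabs (dot y (g n)) <= Rabs (dot x (g n)) ->
        exists x' y', vadd x y = vadd x' y' /\ dot x' (g k) = 0 /\ dot y' (g n) = 0 /\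
          forall m, (m < S n)%nat -> 0 <= dot x' (g m) * dot y' (g m)).
      { clear - n; intros k x y Hk Hx Hxy Hlt Hle.
        assert (Hx0 : dot x (g n) <> 0) by (intros E; rewrite E in Hlt; lra).
        (* The part [lam] of [x] is handed to [y] to make the new second summand orthogonal to
           [g n]; the opposite signs and the smaller product of [y] put [lam] between 0 and 1. *)
        set (lam := - dot y (g n) / dot x (g n)).
        assert (Hlam : lam * dot x (g n) = - dot y (g n)) by (unfold lam; field; exact Hx0).
        assert (Hlam01 : 0 <= lam <= 1).
        { unfold Rabs in Hle; repeat destruct Rcase_abs; split; nra. }
        exists (vscale (1 - lam) x), (vadd (vscale lam x) y); repeat split.
        - pt_ring.
        - rewrite dot_vscale, Hx; ring.
        - rewrite dot_vadd, dot_vscale; lra.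
        - intros m Hm; rewrite dot_vadd, !dot_vscale.
          destruct (Nat.eq_dec m n) as [->|Hmn].
          + rewrite Hlam; nra.
          + assert (H := Hxy m ltac:(lia)).
            replace ((1 - lam) * dot x (g m) * (lam * dot x (g m) + dot y (g m)))
              with ((1 - lam) * (lam * Rsqr (dot x (g m)) + dot x (g m) * dot y (g m)))
              by (unfold Rsqr; ring).
            assert (H' := Rle_0_sqr (dot x (g m))).
            apply Rmult_le_pos; nra. }
      (* The summand whose product with [g n] is smaller in absolute value is the one turned into
         the new direction. *)
      destruct (Rle_dec (Rabs (dot w (g n))) (Rabs (dot u (g n)))) as [Hle|Hle].
      * destruct (Hsplit i u w) as [u' [w' [E [Hu' [Hw' H]]]]]; trivial.
        exists i, n, u', w'; repeat split; try lia; trivial.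
      * destruct (Hsplit j w u) as [u' [w' [E [Hu' [Hw' H]]]]]; trivial; try lra.
        { intros m Hm; rewrite Rmult_comm; auto. }
        exists j, n, u', w'; repeat split; try lia; trivial.
        rewrite <- E; pt_ring.
Qed.

Lemma gnorm_same_signs u w :
  (forall m, (m < N)%nat -> 0 <= dot u (g m) * dot w (g m)) ->
  gnorm (vadd u w) = gnorm u + gnorm w.
Proof.
  intros H; unfold gnorm; rewrite <- rsum_plus; apply rsum_ext; intros m Hm%in_seq0.
  rewrite dot_vadd; specialize (H m Hm).
  unfold Rabs; repeat destruct Rcase_abs; nra.
Qed.

(** If [p] is on no line of family [i], a line of another family through [p] is followed to a line
    of family [i]; the level of family [i] changes by at most one, so the detour has norm at most
    [K]. *)
Lemma reach_line_nearby K i p : 0 <= K ->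
  (forall a i v, (a < N)%nat -> (i < N)%nat ->
     a <> i -> dot v (g a) = 0 -> gnorm v <= K * Rabs (dot v (g i))) ->
  grid_vertex N g gam p -> (i < N)%nat ->
  exists r, grid_vertex N g gam r /\ is_int (level i r) /\ gnorm (vsub r p) <= K /\
    reach p r (K + INR N) /\ reach r p (K + INR N).
Proof.
  intros HK Hbound Hp Hi; assert (HN := pos_INR N).
  assert (Hv := Hp); destruct Hv as [a [b [Ha [Hb [Hab [Ia Ib]]]]]].
  change (is_int (level a p)) in Ia.
  destruct (Nat.eq_dec a i) as [->|Hai].
  - exists p; repeat split; trivial; try (apply reach_refl; lra).
    replace (vsub p p) with vzero by pt_ring; rewrite gnorm_vzero; lra.
  - destruct (solve_dots (g a) (g i) (dot p (g a)) (IZR (ceilZ (level i p)) + gam i))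
      as [r [H1 H2]]; [now apply hnonpar|].
    assert (Ear : level a r = level a p) by (unfold level; now rewrite H1).
    assert (Iir : is_int (level i r)).
    { exists (ceilZ (level i p)); unfold level at 1; rewrite H2; ring. }
    assert (Hr : grid_vertex N g gam r).
    { apply (on_pair_vertex a i); repeat split; trivial; now rewrite Ear. }
    assert (Hd : gnorm (vsub r p) <= K).
    { apply Rle_trans with (K * Rabs (dot (vsub r p) (g i))).
      - apply (Hbound a); trivial; rewrite dot_vsub, H1; ring.
      - rewrite <- (Rmult_1_r K) at 2; apply Rmult_le_compat_l; trivial.
        rewrite dot_vsub, H2.
        assert (Hc := ceilZ_spec (level i p)); unfold level in *.
        apply Rabs_le; lra. }
    exists r; repeat split; trivial.
    + apply reach_mono with (gnorm (vsub r p) + INR N); [lra|].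
      now apply (reach_on_line_gnorm a).
    + apply reach_mono with (gnorm (vsub p r) + INR N); [rewrite gnorm_vsub_sym; lra|].
      apply (reach_on_line_gnorm a); trivial; now rewrite Ear.
Qed.

Lemma vertex_two p : grid_vertex N g gam p -> (2 <= N)%nat.
Proof. intros [i [j [Hi [Hj [Hij _]]]]]; lia. Qed.

(** The path enters a line of family [i] near [p], follows it to a line of family [j] passing near
    [q], and follows that one. Because [u] and [w] have products of equal sign with every [g m],
    their norms add up to the norm of [q - p], and only bounded errors remain. *)
Lemma reach_gnorm : exists C, forall p q, grid_vertex N g gam p -> grid_vertex N g gam q ->
  reach p q (gnorm (vsub q p) + C).
Proof.
  destruct gnorm_line_bound as [K [HK Hbound]].
  (* Two detours cost [K + INR N] each; the two line pieces exceed [gnorm u] and [gnorm w] by at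
     most [2 * K * K + INR N] each. *)
  exists (2 * K + 4 * K * K + 4 * INR N); intros p q Hp Hq.
  destruct (sector_decomp N (vsub q p)) as [i [j [u [w [Hi [Hj [Hij [E [Hu [Hw Hs]]]]]]]]]].
  { split; [exact (vertex_two p Hp)|lia]. }
  destruct (reach_line_nearby K i p) as [r1 [Hr1 [Ir1 [Hd1 [Hpr1 _]]]]]; trivial.
  destruct (reach_line_nearby K j q) as [r3 [Hr3 [Ir3 [Hd3 [_ Hr3q]]]]]; trivial.
  destruct (solve_dots (g i) (g j) (dot r1 (g i)) (dot r3 (g j))) as [r2 [H2i H2j]];
    [now apply hnonpar|].
  assert (E2i : level i r2 = level i r1) by (unfold level; now rewrite H2i).
  assert (E2j : level j r2 = level j r3) by (unfold level; now rewrite H2j).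
  assert (Hr2 : grid_vertex N g gam r2).
  { apply (on_pair_vertex i j); repeat split; trivial; [now rewrite E2i|now rewrite E2j]. }
  assert (Herr : forall m, (m < N)%nat ->
    Rabs (dot (vsub r3 r1) (g m) - dot u (g m) - dot w (g m)) <= 2 * K).
  { intros m Hm.
    assert (E' : dot (vsub q p) (g m) = dot u (g m) + dot w (g m))
      by now rewrite E, dot_vadd.
    assert (H1 := dot_le_gnorm (vsub r1 p) m Hm); assert (H3 := dot_le_gnorm (vsub r3 q) m Hm).
    assert (H4 := Rle_abs (dot (vsub r1 p) (g m))).
    assert (H5 := Rle_abs (- dot (vsub r1 p) (g m))).
    assert (H6 := Rle_abs (dot (vsub r3 q) (g m))).
    assert (H7 := Rle_abs (- dot (vsub r3 q) (g m))).
    rewrite Rabs_Ropp in H5, H7; rewrite !dot_vsub in *.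
    apply Rabs_le; lra. }
  (* Both [r2 - r1] and [u] are orthogonal to [g i], so their difference is controlled by its
     product with [g j]; there [r2] may be replaced by [r3], and [w] contributes nothing. *)
  assert (H12 : gnorm (vsub r2 r1) <= gnorm u + K * (2 * K)).
  { replace (vsub r2 r1) with (vadd u (vsub (vsub r2 r1) u)) by pt_ring.
    apply Rle_trans with (1 := gnorm_vadd _ _), Rplus_le_compat_l.
    apply Rle_trans with (1 := Hbound i j (vsub (vsub r2 r1) u) Hi Hj Hij
      ltac:(rewrite !dot_vsub, Hu, H2i; ring)).
    apply Rmult_le_compat_l; trivial.
    assert (H := Herr j Hj); rewrite Hw in H; rewrite !dot_vsub in *; rewrite H2j.
    now rewrite Rminus_0_r in H. }
  assert (H23 : gnorm (vsub r3 r2) <= gnorm w + K * (2 * K)).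
  { replace (vsub r3 r2) with (vadd w (vsub (vsub r3 r2) w)) by pt_ring.
    apply Rle_trans with (1 := gnorm_vadd _ _), Rplus_le_compat_l.
    apply Rle_trans with (1 := Hbound j i (vsub (vsub r3 r2) w) Hj Hi (not_eq_sym Hij)
      ltac:(rewrite !dot_vsub, Hw, H2j; ring)).
    apply Rmult_le_compat_l; trivial.
    assert (H := Herr i Hi); rewrite Hu in H; rewrite !dot_vsub in *; rewrite H2i.
    now rewrite Rminus_0_r in H. }
  assert (Hg : gnorm (vsub q p) = gnorm u + gnorm w)
    by (rewrite E; now apply gnorm_same_signs).
  apply reach_mono with ((K + INR N) + ((gnorm (vsub r2 r1) + INR N) +
    ((gnorm (vsub r3 r2) + INR N) + (K + INR N)))); [lra|].
  apply reach_trans with r1; trivial.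
  apply reach_trans with r2.
  { now apply (reach_on_line_gnorm i). }
  apply reach_trans with r3; trivial.
  apply (reach_on_line_gnorm j); trivial; now rewrite E2j.
Qed.

(** * Lower bound for the length of chains *)

Lemma tile_neighbours_itself p : grid_vertex N g gam p ->
  neighbours (tile_at N g gam p) (tile_at N g gam p).
Proof.
  intros Hp; assert (Hv := Hp); destruct Hv as [i [_ [Hi [_ [_ [Ii _]]]]]].
  apply (consecutive_neighbours i); trivial; intros; lra.
Qed.

(** Injectivity of the map from vertices to tiles is not presupposed: a tile is its own neighbour,
    so by [neighbours_sep] vertices with the same tile have separation at most one, and one vertex
    per tile of [P0] suffices. *)
Lemma initial_sep_bound p0 P0 : exists C, forall T p, In T P0 ->
  grid_vertex N g gam p -> T = tile_at N g gam p -> sep p0 p <= C.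
Proof.
  induction P0 as [|T P0 [C IH]]; [exists 0; intros T p []|].
  destruct (classic (exists p, grid_vertex N g gam p /\ T = tile_at N g gam p))
    as [[q [Hq Eq]]|Hno].
  - exists (Rmax C (sep p0 q + 1)); intros T' p [<-|HT] Hp Ep.
    + apply Rle_trans with (2 := Rmax_r _ _).
      apply Rle_trans with (1 := sep_triangle p0 q p), Rplus_le_compat_l.
      apply neighbours_sep; trivial; rewrite <- Ep, Eq.
      now apply tile_neighbours_itself.
    + apply Rle_trans with (2 := Rmax_l _ _); now apply (IH T').
  - exists C; intros T' p [<-|HT] Hp Ep.
    + exfalso; apply Hno; now exists p.
    + now apply (IH T').
Qed.

Lemma chain_sep_bound p0 P0 : Forall (is_tile N g gam) P0 -> exists C, forall n T p,
  chain_from (is_tile N g gam) P0 n T -> grid_vertex N g gam p ->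
  T = tile_at N g gam p -> sep p0 p <= INR n + C.
Proof.
  intros HP0; destruct (initial_sep_bound p0 P0) as [C HC]; exists C.
  intros n T p Hch; revert p; induction Hch as [T HT|n T T' Hch IH HT' Hnb]; intros p Hp Ep.
  - assert (H := HC T p HT Hp Ep); simpl; lra.
  - assert (HT : is_tile N g gam T).
    { destruct Hch as [T HT|]; trivial.
      rewrite Forall_forall in HP0; auto. }
    destruct HT as [q [Hq Eq]].
    assert (H1 := IH q Hq Eq); assert (H2 := sep_triangle p0 q p).
    rewrite Eq, Ep in Hnb; assert (H3 := neighbours_sep q p Hq Hp Hnb).
    rewrite S_INR; lra.
Qed.

(** * The growth polygon *)

Definition frame (v : pt) : pt := comb (fun m => dot v (g m)).

Lemma frame_vscale a v : frame (vscale a v) = vscale a (frame v).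
Proof.
  replace (vscale a (frame v)) with (vadd (vscale a (frame v)) (comb (fun _ => 0)))
    by (rewrite comb_zero; pt_ring).
  unfold frame; rewrite comb_lin; apply comb_ext; intros; rewrite dot_vscale; ring.
Qed.

Lemma frame_vadd u v : frame (vadd u v) = vadd (frame u) (frame v).
Proof.
  replace (frame u) with (vscale 1 (frame u)) by pt_ring.
  unfold frame; rewrite comb_lin; apply comb_ext; intros; rewrite dot_vadd; ring.
Qed.

Lemma vnorm_frame v : vnorm (frame v) <= gnorm v.
Proof. apply vnorm_comb. Qed.

(** The product of [frame x] with [x] is the sum of the squares of [dot x (g m)], which vanishes
    only at [vzero] since [g 0] and [g 1] are independent. *)
Lemma frame_inj u v : (2 <= N)%nat -> frame u = frame v -> u = v.
Proof.
  intros HN E; apply vsub_eq0.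
  assert (H : dot (frame (vsub u v)) (vsub u v) = 0).
  { unfold vsub at 1; rewrite frame_vadd, frame_vscale, E.
    unfold dot, vadd, vscale; simpl; ring. }
  unfold frame in H; rewrite dot_comb in H.
  assert (H0 : forall m, (m < N)%nat -> dot (vsub u v) (g m) = 0).
  { intros m Hm; apply Rsqr_0_uniq.
    apply (rsum_nonneg_eq0 (fun m => Rsqr (dot (vsub u v) (g m))) (seq 0 N));
      [intros; apply Rle_0_sqr|exact H|now apply in_seq0]. }
  apply (dots_eq0 (g 0%nat) (g 1%nat)); [apply hnonpar; lia|apply H0; lia|apply H0; lia].
Qed.

Lemma gnorm_pos v : (2 <= N)%nat -> v <> vzero -> 0 < gnorm v.
Proof.
  intros HN Hv; destruct (gnorm_nonneg v) as [H|H]; trivial.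
  exfalso; apply Hv, (dots_eq0 (g 0%nat) (g 1%nat)); [apply hnonpar; lia| |];
    [assert (H1 := dot_le_gnorm v 0 ltac:(lia))|assert (H1 := dot_le_gnorm v 1 ltac:(lia))];
    rewrite <- H in H1; unfold Rabs in H1; destruct Rcase_abs; lra.
Qed.

Lemma gnorm_perp_pos i : (2 <= N)%nat -> (i < N)%nat -> 0 < gnorm (perp (g i)).
Proof.
  intros HN Hi; apply gnorm_pos; trivial; intros E.
  assert (H := vnorm_perp (g i)); rewrite E, hunit in H by trivial.
  assert (H' := vnorm_sqr vzero); rewrite H in H'.
  unfold dot, vzero in H'; simpl in H'; lra.
Qed.

(** The sine of the arccosine of |c| is the root of 1 - c^2, and for unit vectors dot^2 + det^2 = 1
    by Lagrange's identity. *)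
Lemma inv_delta i j : (i < N)%nat -> (j < N)%nat -> / delta g i j = Rabs (det2 (g i) (g j)).
Proof.
  intros Hi Hj; unfold delta, alpha; rewrite Rinv_inv.
  assert (Hi1 := dot_gg i Hi); assert (Hj1 := dot_gg j Hj).
  assert (H : Rsqr (det2 (g i) (g j)) = 1 - Rsqr (Rabs (dot (g i) (g j)))).
  { rewrite <- Rsqr_abs.
    replace 1 with (dot (g i) (g i) * dot (g j) (g j)) by (rewrite Hi1, Hj1; ring).
    unfold dot, det2, Rsqr; ring. }
  rewrite sin_acos, <- H, sqrt_Rsqr_abs; trivial.
  assert (H1 := dot_g_le (g i) j Hj); rewrite hunit in H1 by trivial.
  assert (H2 := Rabs_pos (dot (g i) (g j))); lra.
Qed.

Lemma Delta_gnorm i : (i < N)%nat -> Defs.Delta N g i = gnorm (perp (g i)).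
Proof.
  intros Hi; apply rsum_ext; intros j Hj%in_seq0; rewrite dot_perp.
  destruct (Nat.eq_dec j i) as [->|Hji].
  - unfold det2; rewrite <- Rabs_R0; f_equal; ring.
  - now apply inv_delta.
Qed.

(** The sign [epsij] restores the sign lost in [/ delta], leaving [det2 (g i) (g j)], the product of
    [perp (g i)] with [g j]. *)
Lemma upsilon_frame i : (i < N)%nat -> upsilon N g i = frame (perp (g i)).
Proof.
  intros Hi.
  transitivity (comb (fun j => if Nat.eq_dec j i then 0 else epsij g i j / delta g i j)).
  - apply pt_eq; unfold upsilon, comb; rewrite ?fst_vsum, ?snd_vsum;
      apply rsum_ext; intros j _; destruct (Nat.eq_dec j i); simpl; ring.
  - apply comb_ext; intros j Hj; rewrite dot_perp; destruct (Nat.eq_dec j i) as [->|Hji].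
    + unfold det2; ring.
    + unfold Rdiv; rewrite inv_delta by trivial; unfold epsij, Dij.
      destruct Rlt_dec; [rewrite Rabs_right|rewrite Rabs_left1]; lra.
Qed.

Lemma polygon_vertex_frame y : (2 <= N)%nat -> polygon_vertices N g y ->
  exists u, y = frame u /\ gnorm u = 1.
Proof.
  intros HN [i [Hi Hy]]; assert (Hpos := gnorm_perp_pos i HN Hi).
  assert (Hinv := Rinv_0_lt_compat _ Hpos).
  rewrite Delta_gnorm, upsilon_frame in Hy by trivial.
  destruct Hy as [-> | ->]; rewrite <- frame_vscale; eexists; split; try reflexivity;
    rewrite gnorm_vscale, ?Rabs_Ropp, Rabs_right by lra; field; lra.
Qed.

(** The image of the unit ball of [gnorm] under the linear map [frame] is convex and contains the
    vertices. *)
Lemma conv_polygon_frame y : (2 <= N)%nat -> conv (polygon_vertices N g) y ->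
  exists u, y = frame u /\ gnorm u <= 1.
Proof.
  intros HN [l [Hl [<- ->]]].
  induction l as [|[w x] l IH]; simpl.
  - exists vzero; split.
    + rewrite <- comb_zero at 1; apply comb_ext; intros; unfold dot, vzero; simpl; ring.
    + rewrite gnorm_vzero; lra.
  - apply Forall_cons_iff in Hl as [[Hw Hx] Hl]; simpl in Hw, Hx.
    destruct (IH Hl) as [u [-> Hu]], (polygon_vertex_frame x HN Hx) as [v [-> Hv]].
    exists (vadd (vscale w v) u); rewrite frame_vadd, frame_vscale; split; trivial.
    apply Rle_trans with (1 := gnorm_vadd _ _).
    rewrite gnorm_vscale, Hv, Rabs_right; lra.
Qed.

(** Such a [u] is a multiple of [perp (g i)]; the sign of the factor selects one of the two opposite
    vertices. *)
Lemma line_vertex i u : (2 <= N)%nat -> (i < N)%nat -> dot u (g i) = 0 ->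
  exists y, polygon_vertices N g y /\ frame u = vscale (gnorm u) y.
Proof.
  intros HN Hi Hu; assert (Hpos := gnorm_perp_pos i HN Hi).
  rewrite (perp_decomp (g i) u) by (trivial; now apply dot_gg).
  set (a := dot u (perp (g i))).
  rewrite frame_vscale, gnorm_vscale, <- upsilon_frame, <- Delta_gnorm by trivial.
  rewrite <- Delta_gnorm in Hpos by trivial.
  destruct (Rle_dec 0 a) as [Ha|Ha].
  - exists (vscale (/ Defs.Delta N g i) (upsilon N g i)); split.
    + exists i; auto.
    + rewrite Rabs_right by lra; apply pt_eq; unfold vscale; simpl; field; lra.
  - exists (vscale (- / Defs.Delta N g i) (upsilon N g i)); split.
    + exists i; auto.
    + rewrite Rabs_left1 by lra; apply pt_eq; unfold vscale; simpl; field; lra.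
Qed.

(** By [sector_decomp] the image is a convex combination of two vertices, with weights [gnorm u] and
    [gnorm w]. Scaling it by [1 + eps / 2] leaves the hull, since [frame] is injective and the hull
    lies in the image of the unit ball. *)
Lemma gnorm_sphere_polygon v : (2 <= N)%nat -> gnorm v = 1 -> growth_polygon N g (frame v).
Proof.
  intros HN Hv; split; intros eps Heps.
  - exists (frame v); split.
    + unfold Defs.dist; replace (vsub (frame v) (frame v)) with (vscale 0 vzero) by pt_ring.
      rewrite vnorm_vscale, Rabs_R0; lra.
    + destruct (sector_decomp N v) as [i [j [u [w [Hi [Hj [_ [-> [Hu [Hw Hs]]]]]]]]]]; [lia|].
      destruct (line_vertex i u HN Hi Hu) as [y [Hy Ey]].
      destruct (line_vertex j w HN Hj Hw) as [z [Hz Ez]].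
      exists ((gnorm u, y) :: (gnorm w, z) :: nil); split; [|split].
      * repeat (apply Forall_cons; [split; simpl; [apply gnorm_nonneg|trivial]|]).
        apply Forall_nil.
      * simpl; rewrite <- Hv, gnorm_same_signs by trivial; ring.
      * simpl; rewrite frame_vadd, Ey, Ez; pt_ring.
  - assert (Hn := vnorm_frame v); assert (Hn' := vnorm_pos (frame v)).
    exists (vscale (1 + eps / 2) (frame v)); split.
    + unfold Defs.dist.
      replace (vsub (vscale (1 + eps / 2) (frame v)) (frame v))
        with (vscale (eps / 2) (frame v)) by pt_ring.
      rewrite vnorm_vscale, Rabs_right by lra; nra.
    + intros Hc; apply conv_polygon_frame in Hc as [u [Eu Hu]]; trivial.
      rewrite <- frame_vscale in Eu; apply frame_inj in Eu; trivial.
      rewrite <- Eu, gnorm_vscale, Hv, Rabs_right in Hu; lra.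
Qed.

(** * From distances to the growth form *)

Lemma gnorm_direction v : (2 <= N)%nat -> exists e, gnorm e = 1 /\ v = vscale (gnorm v) e.
Proof.
  intros HN; destruct (classic (v = vzero)) as [->|Hv].
  (* For the zero vector, which arises at the base vertex itself, any vector of norm one serves. *)
  - assert (Hpos := gnorm_perp_pos 0 HN ltac:(lia)).
    exists (vscale (/ gnorm (perp (g 0%nat))) (perp (g 0%nat))); split.
    + rewrite gnorm_vscale, Rabs_right; [field; lra|].
      apply Rle_ge, Rlt_le, Rinv_0_lt_compat, Hpos.
    + rewrite gnorm_vzero; pt_ring.
  - assert (Hpos := gnorm_pos v HN Hv).
    exists (vscale (/ gnorm v) v); split.
    + rewrite gnorm_vscale, Rabs_right; [field; lra|].
      apply Rle_ge, Rlt_le, Rinv_0_lt_compat, Hpos.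
    + apply pt_eq; unfold vscale; simpl; field; lra.
Qed.

(** Each filled value is within one of [level m p], and the levels are the coefficients of [frame p]
    shifted by [gam]. *)
Lemma tile_near_frame p y : tile_at N g gam p y ->
  vnorm (vsub y (vsub (frame p) (comb gam))) <= INR N.
Proof.
  intros Hy; apply tile_zonotope in Hy as [z [Hz ->]].
  unfold frame; rewrite !comb_sub.
  apply Rle_trans with (1 := vnorm_comb _).
  apply Rle_trans with (rsum (fun _ => 1) (seq 0 N));
    [|rewrite rsum_const, length_seq; lra].
  apply rsum_le; intros m Hm%in_seq0; apply filled_dist, Hz, Hm.
Qed.

Lemma grid_growth_form P0 : P0 <> nil -> Forall (is_tile N g gam) P0 ->
  growth_form_wrt (is_tile N g gam) P0 (growth_polygon N g).
Proof.
  intros Hnil HP0.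
  destruct P0 as [|T0 P0']; [contradiction|set (P0 := T0 :: P0') in *].
  assert (HT0 : is_tile N g gam T0) by (rewrite Forall_forall in HP0; apply HP0; now left).
  destruct HT0 as [p0 [Hp0 ET0]].
  assert (HN := vertex_two p0 Hp0).
  destruct (chain_sep_bound p0 P0 HP0) as [C1 HC1].
  destruct reach_gnorm as [C2 HC2].
  (* The first [INR N] is the distance of a tile point from the translated image of its vertex; the
     bracket bounds the difference of [gnorm (p - p0)] and [n], with absolute values because [C1]
     and [C2] may be negative. *)
  exists (vsub (frame p0) (comb gam)), (INR N + (Rabs C1 + INR N + Rabs C2)).
  intros n T [[p [Hp ET]] [Hch Hmin]] y Hy.
  assert (Hlow : gnorm (vsub p p0) <= INR n + C1 + INR N).
  { assert (H1 := HC1 n T p Hch Hp ET); assert (H2 := sep_gnorm p0 p).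
    assert (H3 := Rle_abs (- (sep p0 p - gnorm (vsub p0 p)))); rewrite Rabs_Ropp in H3.
    rewrite gnorm_vsub_sym; lra. }
  (* By minimality of [n], the chain from [T0] to [T] supplied by [reach_gnorm] has length at least
     [n]. *)
  assert (Hup : INR n <= gnorm (vsub p p0) + C2).
  { destruct (HC2 p0 p Hp0 Hp) as [L [HL HL']].
    apply Rle_trans with (INR L); trivial; apply le_INR.
    destruct (Nat.le_gt_cases n L) as [|Hlt]; trivial.
    exfalso; apply (Hmin L Hlt); rewrite ET; apply (HL' P0 0%nat).
    apply chain0; rewrite <- ET0; now left. }
  destruct (gnorm_direction (vsub p p0) HN) as [e [He Ee]].
  exists (frame e); split; [now apply gnorm_sphere_polygon|].
  set (v := vsub p p0) in *.
  unfold Defs.dist.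
  replace (vsub y (vadd (vsub (frame p0) (comb gam)) (vscale (INR n) (frame e))))
    with (vadd (vsub y (vsub (frame p) (comb gam))) (vscale (gnorm v - INR n) (frame e))).
  - apply Rle_trans with (1 := vnorm_vadd _ _), Rplus_le_compat.
    + apply tile_near_frame; now rewrite <- ET.
    + rewrite vnorm_vscale.
      assert (H1 := vnorm_frame e); rewrite He in H1; assert (H2 := vnorm_pos (frame e)).
      assert (H3 : Rabs (gnorm v - INR n) <= Rabs C1 + INR N + Rabs C2).
      { assert (H4 := Rle_abs C1); assert (H5 := Rle_abs C2); assert (H6 := pos_INR N).
        assert (H7 := Rabs_pos C1); assert (H8 := Rabs_pos C2).
        apply Rabs_le; lra. }
      assert (H9 := Rabs_pos (gnorm v - INR n)); nra.
  - replace (frame p) with (vadd (frame p0) (vscale (gnorm v) (frame e))); [pt_ring|].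
    rewrite <- frame_vscale, <- Ee, <- frame_vadd; f_equal; unfold v; pt_ring.
Qed.

End Grid.

Theorem theorem3 (N : nat) (g : nat -> pt) (gam : nat -> R)
  (hunit : forall i, (i < N)%nat -> vnorm (g i) = 1)
  (hnonpar : forall i j, (i < N)%nat -> (j < N)%nat -> i <> j -> det2 (g i) (g j) <> 0)
  (hreg : regular_grid N g gam) :
  forall P0 : list (pt -> Prop),
    P0 <> nil -> Forall (is_tile N g gam) P0 ->
    growth_form_wrt (is_tile N g gam) P0 (growth_polygon N g).
Proof.
  exact (grid_growth_form N g gam hunit hnonpar hreg).
Qed.
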